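(* The combination $L_{0,a}+\exists^2$ computes $\exists^3$.
   Context: Computability is Kleene's higher-order computability (S1–S9), extended to partial functionals. Subsets of $[0,1]$ are given by characteristic functions. $L_{0,a}$ is the functional defined for all subsets $E\subseteq[0,1]$ which decides whether the boundary $\partial E$ has Lebesgue measure zero. $\exists^2:\mathbb{N}^{\mathbb{N}}\to\{0,1\}$ satisfies $\exists^2(g)=0\leftrightarrow(\exists n)(g(n)=0)$. Kleene's $\exists^3:(\mathbb{N}^{\mathbb{N}}\to\mathbb{N})\to\{0,1\}$ satisfies $\exists^3(Y)=0\leftrightarrow(\exists f\in\mathbb{N}^{\mathbb{N}})(Y(f)=0)$. *)

(* Defs.v *)
From HB Require Import structures.
From Stdlib Require Import Arith.Cantor.
From mathcomp Require Import all_boot all_order all_algebra.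
From mathcomp Require Import all_classical all_reals all_analysis.

Set Implicit Arguments.
Unset Strict Implicit.
Unset Printing Implicit Defensive.

Import Order.TTheory GRing.Theory Num.Theory.
Import numFieldNormedType.Exports.

Local Open Scope classical_set_scope.
Local Open Scope nat_scope.

(** * Pure types, in the full type structure over nat *)

Fixpoint tp (n : nat) : Type := if n is m.+1 then tp m -> nat else nat.

(* A partial functional of type m.+1 takes total arguments of type m; [None]
   stands for "undefined".  The objects of type 0 are always numbers. *)
Definition ptp (n : nat) : Type := if n is m.+1 then tp m -> option nat else nat.

Definition of_total (n : nat) : tp n -> ptp n :=
  match n with 0 => fun x => x | _.+1 => fun F x => Some (F x) end.

Definition arg : Type := {n : nat & ptp n}.
Definition Arg (n : nat) (x : ptp n) : arg := existT ptp n x.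
Definition TArg (n : nat) (x : tp n) : arg := Arg (of_total x).
Definition Num (x : nat) : arg := @Arg 0 x.

(** * Kleene's schemes S1-S9 *)

(* [kleene e a v] is {e}(a) = v.  The indices are numbers, namely codes of
   finite sequences <i, ...> with i the number of the scheme.  S8 has a value
   only if the abstracted functional is total and belongs to the domain of the
   (possibly partial) functional [F] it is fed to. *)
Inductive kleene : nat -> seq arg -> nat -> Prop :=
| S1 x a :
    kleene (CodeSeq.code [:: 1]) (Num x :: a) x.+1
| S2 q a :
    kleene (CodeSeq.code [:: 2; q]) a q
| S3 x a :
    kleene (CodeSeq.code [:: 3]) (Num x :: a) x
| S4 d e a w v :
    kleene e a w -> kleene d (Num w :: a) v ->
    kleene (CodeSeq.code [:: 4; d; e]) a v
| S5_0 d e a v :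
    kleene d a v ->
    kleene (CodeSeq.code [:: 5; d; e]) (Num 0 :: a) v
| S5_S d e x a w v :
    kleene (CodeSeq.code [:: 5; d; e]) (Num x :: a) w ->
    kleene e (Num x :: Num w :: a) v ->
    kleene (CodeSeq.code [:: 5; d; e]) (Num x.+1 :: a) v
| S6 d a x b v :
    kleene d (x :: a ++ b) v ->
    kleene (CodeSeq.code [:: 6; size a; d]) (a ++ x :: b) v
| S7 (f : ptp 1) x a v :
    f x = Some v ->
    kleene (CodeSeq.code [:: 7]) (Arg f :: Num x :: a) v
| S8 n (F : ptp n.+2) (G : tp n.+1) d a v :
    (forall x : tp n, kleene d (TArg x :: Arg F :: a) (G x)) ->
    F G = Some v ->
    kleene (CodeSeq.code [:: 8; d]) (Arg F :: a) v
| S9 d a b v :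
    kleene d a v ->
    kleene (CodeSeq.code [:: 9; size a]) (Num d :: a ++ b) v.

Lemma Arg_inj n : injective (@Arg n).
Proof. exact: eq_from_Tagged. Qed.

Lemma cat_size_inj T (a b a' b' : seq T) :
  size a = size a' -> a ++ b = a' ++ b' -> a = a' /\ b = b'.
Proof.
elim: a a' => [|x a IH] [|y a'] //= [sz] [-> eq_ab].
by have [-> ->] := IH _ sz eq_ab.
Qed.

(* Hence {e} denotes a partial function. *)
Lemma kleene_fun e a v v' : kleene e a v -> kleene e a v' -> v = v'.
Proof.
have inj := can_inj CodeSeq.codeK.
have cons_inj (x y : arg) s t : x :: s = y :: t -> x = y /\ s = t by case.
suff gen : kleene e a v ->
    forall e' a' w, kleene e' a' w -> e' = e -> a' = a -> v = w.
  by move=> H H'; exact: gen H _ _ _ H' erefl erefl.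
elim=> {e a v v'} [x a|q a|x a|d e a w v _ IHw _ IHv|d e a v _ IH
  |d e x a w v _ IHw _ IHv|d a x b v _ IH|f x a v fx|n F G d a v _ IH FG
  |d a b v _ IH] _ _ _ [x' a'|q' a'|x' a'|d' e' a' w' v' Hw Hv|d' e' a' v' H'
  |d' e' x' a' w' v' Hw Hv|d' a' x' b' v' H'|f' x' a' v' fx'
  |n' F' G' d' a' v' H' FG'|d' a' b' v' H'] /inj // eq_e eq_a.
- by have [/Arg_inj ->] := cons_inj _ _ _ _ eq_a.
- by case: eq_e.
- by have [/Arg_inj] := cons_inj _ _ _ _ eq_a.
- case: eq_e => ? ?; subst.
  by move: Hv; rewrite -(IHw _ _ _ Hw erefl erefl) => /IHv; exact.
- case: eq_e => ? ?; have [_ ?] := cons_inj _ _ _ _ eq_a; subst.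
  exact: IH H' erefl erefl.
- by have [/Arg_inj] := cons_inj _ _ _ _ eq_a.
- by have [/Arg_inj] := cons_inj _ _ _ _ eq_a.
- case: eq_e => ? ?; have [/Arg_inj [?] ?] := cons_inj _ _ _ _ eq_a; subst.
  by move: Hv; rewrite -(IHw _ _ _ Hw erefl erefl) => /IHv; exact.
- case: eq_e => sz ?; have [? /cons_inj [? ?]] := cat_size_inj sz eq_a; subst.
  exact: IH H' erefl erefl.
- have [/Arg_inj ? /cons_inj [/Arg_inj ? _]] := cons_inj _ _ _ _ eq_a; subst.
  by move: fx'; rewrite fx => -[].
- have [eq_F ?] := cons_inj _ _ _ _ eq_a.
  have [?] : n'.+2 = n.+2 := congr1 tag eq_F; subst n'.
  case: eq_e => ?; move/Arg_inj: eq_F => ?; subst.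
  have ? : G = G' by apply: funext => x; exact: IH (H' x) erefl erefl.
  by subst G'; move: FG'; rewrite FG => -[].
- case: eq_e => sz; have [/Arg_inj ? /(cat_size_inj sz) [? _]] :=
    cons_inj _ _ _ _ eq_a; subst.
  exact: IH H' erefl erefl.
Qed.

(* [Phi] is computable in the list [a] of (partial) functionals: some index [e]
   satisfies {e}(a, x) = Phi(x) for all x, one side being defined exactly when
   the other is. *)
Definition computes (a : seq arg) (n : nat) (Phi : ptp n.+1) : Prop :=
  exists e : nat, forall (x : tp n) (v : nat),
    kleene e (a ++ [:: TArg x]) v <-> Phi x = Some v.

(** * Kleene's quantifiers *)

(* The value 0 stands for "yes". *)
Definition decide (P : Prop) : nat := if `[< P >] then 0 else 1.

Definition kleene_E2 : tp 2 :=
  fun g : tp 1 => decide (exists n : nat, g n = 0).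

Definition kleene_E3 : tp 3 :=
  fun Y : tp 2 => decide (exists f : tp 1, Y f = 0).

(** * Real numbers and subsets of the unit interval as objects of pure type *)

Local Open Scope ring_scope.

Definition rat_of_code (n : nat) : rat :=
  let: (a, b) := Cantor.of_nat n in
  (if odd a then - (uphalf a)%:R else (half a)%:R) / b.+1%:R.

(* [alpha] is a fast-converging Cauchy sequence of rationals with limit [x]. *)
Definition codes_real (R : realType) (alpha : tp 1) (x : R) : Prop :=
  (forall n i : nat,
     `|rat_of_code (alpha n) - rat_of_code (alpha (n + i)%N)| < 2 ^- n) /\
  (fun n : nat => ratr (rat_of_code (alpha n)) : R) @ \oo --> x.

(* The values of [F] at sequences that do not code an element of [0, 1] are
   irrelevant; at codes of the same real, [F] takes the same value. *)
Definition is_characteristic (R : realType) (F : tp 2) (E : set R) : Prop :=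
  E `<=` [set x | 0 <= x <= 1] /\
  forall (alpha : tp 1) (x : R), 0 <= x <= 1 -> codes_real alpha x ->
    F alpha = (if x \in E then 1%N else 0%N).

(* The set with characteristic function [F], when there is one. *)
Definition subset_of (R : realType) (F : tp 2) : set R :=
  [set x | 0 <= x <= 1 /\ exists2 alpha, codes_real alpha x & F alpha = 1%N].

Definition boundary (T : topologicalType) (A : set T) : set T :=
  closure A `\` interior A.

Definition L0a (R : realType) : ptp 3 := fun F : tp 2 =>
  if `[< exists E : set R, is_characteristic F E >]
  then Some (decide (lebesgue_measure (boundary (subset_of F : set R)) = 0%E))
  else None.

(* Main.v *)
(** Read a real [x] in binary, and let [decode x n m] be the least [k] such that
    the digit of [x] with index [n + position m k] is 1, [position] being
    injective.  Every sequence [f] is [decode x n] for densely many [x], with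
    [n] depending on [x]: prescribe the first digits, then code the graph of [f]
    in the tail.  Let [E] consist of the [x] in [0, 1] with infinitely many
    digits 0 such that [Y (decode x n) = 0] for some [n].  If [Y] has no zero,
    then [E] is empty; otherwise [E] is dense in [0, 1], and so is its
    complement, which contains the dyadic rationals, so that the boundary of [E]
    is [0, 1].  Hence [L0a] applied to the characteristic function of [E] decides
    whether [Y] has a zero, and this function is computable in [Y] and
    [kleene_E2].  Unbounded search is needed for [decode]; it is the only place
    where S9 is used. *)

Require Import Defs.
From Stdlib Require Import Arith.Cantor.
From mathcomp Require Import all_boot all_order all_algebra.
From mathcomp Require Import all_classical all_reals all_analysis.
From mathcomp Require Import measurable_realfun.
From mathcomp Require Import zify lra ring.

Set Implicit Arguments.
Unset Strict Implicit.
Unset Printing Implicit Defensive.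

Import Order.TTheory GRing.Theory Num.Theory.
Import numFieldNormedType.Exports.

Local Open Scope classical_set_scope.
Local Open Scope nat_scope.

Local Notation num := Defs.Num.

(** * Programming with S1-S9 *)

(** Each scheme acts on leading arguments whose number its index fixes, or hands the whole list on,
    so an extra tail is carried along. *)
Lemma kleene_weaken e a b v : kleene e a v -> kleene e (a ++ b) v.
Proof.
elim=> {e a v} /=.
- by move=> x a; exact: S1.
- by move=> q a; exact: S2.
- by move=> x a; exact: S3.
- by move=> d e a w v _ He _ Hd; exact: S4 He Hd.
- by move=> d e a v _; exact: S5_0.
- by move=> d e x a w v _ Hw _; exact: S5_S Hw.
- by move=> d a x c v _; rewrite -!catA /= => H; exact: S6.
- by move=> f x a v; exact: S7.
- by move=> n F G d a v _ H; exact: S8.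
- by move=> d a c v H _; rewrite -catA; exact: S9.
Qed.

Definition front m d := CodeSeq.code [:: 6; m; d].

Lemma kleene_front m d a x b v :
  size a = m -> kleene d (x :: a ++ b) v -> kleene (front m d) (a ++ x :: b) v.
Proof. by move=> <-; exact: S6. Qed.

(** [front m] rotates the first m + 1 arguments by one place; m such rotations give the inverse one,
    sending the first argument to position m. *)
Definition back m d := iter m (front m) d.

Lemma kleene_back m d a x b v :
  size a = m -> kleene d (a ++ x :: b) v -> kleene (back m d) (x :: a ++ b) v.
Proof.
move=> sa H.
suff gen j l : size l = m.+1 -> j <= m.+1 -> kleene d (rotr j l ++ b) v ->
    kleene (iter j (front m) d) (l ++ b) v.
  apply: (gen m (x :: a)); rewrite /= ?sa //.
  have -> : rotr m (x :: a) = a ++ [:: x].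
    by rewrite /rotr /= sa subSn // subnn rot1_cons cats1.
  by rewrite -catA.
elim: j l => [|j IH] l sl jm; first by rewrite /rotr subn0 rot_size.
move=> Hl; rewrite iterS.
case/lastP: l sl Hl => // l y; rewrite size_rcons => -[sl] Hl.
rewrite -cats1 -catA; apply: kleene_front => //.
apply: (IH (y :: l)) => //=; rewrite ?sl //; first by lia.
suff <- : rotr j.+1 (rcons l y) = rotr j (y :: l) by [].
rewrite /rotr size_rcons /= sl subSS -rot1_cons -rotD /= ?sl.
  by rewrite addn1 subSn.
by rewrite addn1 ltnS leq_subr.
Qed.

(** The unwanted argument is moved behind [a], where it is harmless by weakening. *)
Lemma kleene_drop m d a x v :
  size a = m -> kleene d a v -> kleene (back m d) (x :: a) v.
Proof.
move=> sa /(@kleene_weaken _ _ [:: x]) H.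
by have := kleene_back sa H; rewrite cats0.
Qed.

(* S8 for a functional in an arbitrary position, which it keeps in the
   arguments of [d]. *)
Definition abstr m d := front m (CodeSeq.code [:: 8; front 1 (back m.+1 d)]).

Lemma kleene_abstr m n (F : ptp n.+2) (G : tp n.+1) d a b v :
  size a = m -> (forall x : tp n, kleene d (TArg x :: a ++ Arg F :: b) (G x)) ->
  F G = Some v -> kleene (abstr m d) (a ++ Arg F :: b) v.
Proof.
move=> sa H FG; apply: kleene_front => //; apply: S8 FG => x.
apply: (@kleene_front _ _ [:: TArg x]) => //=.
by apply: (@kleene_back _ _ (TArg x :: a)) (H x) => /=; rewrite sa.
Qed.

(** The arbitrary tail [a] lets the program run inside any longer list of arguments. *)
Definition computable1 (f : nat -> nat) :=
  exists e, forall x a, kleene e (num x :: a) (f x).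

Definition computable2 (f : nat -> nat -> nat) :=
  exists e, forall x y a, kleene e (num x :: num y :: a) (f x y).

(** * Arithmetic by primitive recursion *)

Lemma computable2_add : computable2 addn.
Proof.
exists (CodeSeq.code [:: 5; CodeSeq.code [:: 3]; front 1 (CodeSeq.code [:: 1])]).
move=> x y a; elim: x => [|x IH]; first by apply: S5_0; exact: S3.
by apply: S5_S IH _; apply: (@kleene_front _ _ [:: _]) => //; exact: S1.
Qed.

Lemma computable2_mul : computable2 muln.
Proof.
have [e He] := computable2_add.
exists (CodeSeq.code [:: 5; CodeSeq.code [:: 2; 0]; front 2 (front 2 e)]).
move=> x y a; elim: x => [|x IH]; first by apply: S5_0; exact: S2.
apply: S5_S IH _; rewrite mulSn addnC.
apply: (@kleene_front _ _ [:: num x; num _]) => //.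
by apply: (@kleene_front _ _ [:: num y; num x]) => //; exact: He.
Qed.

Lemma computable2_sub : computable2 subn.
Proof.
have [p Hp] : computable1 predn.
  exists (CodeSeq.code [:: 5; CodeSeq.code [:: 2; 0]; CodeSeq.code [:: 3]]).
  move=> x a; elim: x => [|x IH]; first by apply: S5_0; exact: S2.
  by apply: S5_S IH _; exact: S3.
exists (front 1 (CodeSeq.code [:: 5; CodeSeq.code [:: 3]; front 1 p])).
move=> x y a; apply: (@kleene_front _ _ [:: num x]) => //.
elim: y => [|y IH]; first by rewrite subn0; apply: S5_0; exact: S3.
by apply: S5_S IH _; apply: (@kleene_front _ _ [:: _]) => //; rewrite subnS.
Qed.

Lemma computable1_exp2 : computable1 (expn 2).
Proof.
have [e He] := computable2_add.
exists (CodeSeq.code [:: 5; CodeSeq.code [:: 2; 1];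
  front 1 (CodeSeq.code [:: 4; e; CodeSeq.code [:: 3]])]).
move=> x a; elim: x => [|x IH]; first by apply: S5_0; exact: S2.
apply: S5_S IH _; apply: (@kleene_front _ _ [:: _]) => //=.
by apply: S4; [exact: S3|rewrite expnS mul2n -addnn].
Qed.

(** The default 0 makes the operator total and agrees with a search that stops at once. *)
Definition least_zero (g : nat -> nat) : nat :=
  if pselect (exists n, g n == 0) is left h then ex_minn h else 0.

Lemma least_zero_unique (g : nat -> nat) k :
  (forall n, (g n == 0) = (n == k)) -> least_zero g = k.
Proof.
move=> gk; rewrite /least_zero; case: pselect => [h|[]].
  by case: ex_minnP => n; rewrite gk => /eqP.
by exists k; rewrite gk.
Qed.

(* The index of the search program is its own first argument, so S9 suffices
   for the recursive call. *)
Lemma kleene_search (e m : nat) :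
  exists e', forall a (p : nat -> nat) k, size a = m ->
    (forall x, kleene e (num x :: a) (p x)) ->
    p k = 0 -> (forall x, x < k -> p x != 0) -> kleene e' a k.
Proof.
(* [again] discards the two arguments that S5 adds, increases the counter and calls [body] by S9. *)
pose again := back m.+3 (back m.+2 (front 1 (CodeSeq.code [:: 4;
  front 1 (back m.+2 (front 1 (CodeSeq.code [:: 4; CodeSeq.code [:: 9; m.+2];
    CodeSeq.code [:: 3]]))); CodeSeq.code [:: 1]]))).
(* A branch on [p i]: at 0 the counter is returned, otherwise [again] runs. *)
pose test := CodeSeq.code [:: 5; front 1 (CodeSeq.code [:: 3]); again].
pose body := CodeSeq.code [:: 4; test; back m.+1 e].
exists (CodeSeq.code [:: 4; CodeSeq.code [:: 4; body; CodeSeq.code [:: 2; body]];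
  CodeSeq.code [:: 2; 0]]).
move=> a p k sa He pk pmin.
suff run : forall j i, i + j = k -> kleene body (num body :: num i :: a) k.
  by apply: S4; [exact: S2|apply: S4; [exact: S2|exact: run k 0 (add0n k)]].
have Hagain i y w : kleene body (num body :: num i.+1 :: a) k ->
    kleene again (num y :: num w :: num body :: num i :: a) k.
  move=> H; apply: kleene_drop; first by rewrite /= sa.
  apply: kleene_drop; first by rewrite /= sa.
  apply: (@kleene_front _ _ [:: num body]) => //=.
  apply: S4; first exact: S1.
  apply: (@kleene_front _ _ [:: num i.+1]) => //=.
  apply: kleene_drop; first by rewrite /= sa.
  apply: (@kleene_front _ _ [:: num i.+1]) => //=.
  apply: S4; first exact: S3.
  have -> : m.+2 = size (num body :: num i.+1 :: a) by rewrite /= sa.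
  by have := S9 [::] H; rewrite cats0.
elim=> [|j IH] i ik.
  rewrite addn0 in ik; subst i; apply: S4.
    by apply: kleene_drop (He k); rewrite /= sa.
  by rewrite pk; apply: S5_0; apply: (@kleene_front _ _ [:: _]) => //; exact: S3.
apply: S4; first by apply: kleene_drop (He i); rewrite /= sa.
have ltik : i < k by rewrite -ik addnS ltnS leq_addr.
move: (pmin i ltik).
case: (p i) => // x _; have {}IH := IH i.+1 (etrans (addSnnS i j) ik).
(* The branch is a primitive recursion on [p i], so its values at smaller arguments must exist too:
   [i] at 0, and [k] above. *)
elim: x => [|x IHx].
  apply: (@S5_S _ _ _ _ i); last exact: Hagain IH; apply: S5_0.
  by apply: (@kleene_front _ _ [:: _]) => //; exact: S3.
by apply: (@S5_S _ _ _ _ k) => //; exact: Hagain IH.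
Qed.

(** * Functions definable from a sequence, [kleene_E2] and [Y] *)

Section Definable.
Variable L : ptp 3.

(** The order in which S8 presents the arguments when it abstracts over [al] to form the argument of
    [L]. *)
Definition oracles (al : tp 1) (Y : tp 2) : seq arg :=
  [:: TArg al; Arg L; TArg (kleene_E2 : tp 2); TArg Y].

Definition input al Y (s : seq nat) : seq arg :=
  [seq num x | x <- s] ++ oracles al Y.

Lemma size_input al Y s : size (input al Y s) = size s + 4.
Proof. by rewrite size_cat size_map. Qed.

(** One index serves all environments of length [k]; the length fixes the positions of the
    oracles. *)
Definition definable k (g : tp 1 -> tp 2 -> seq nat -> nat) := exists e,
  forall al Y s, size s = k -> kleene e (input al Y s) (g al Y s).

Lemma definable_const k q : definable k (fun _ _ _ => q).
Proof. by exists (CodeSeq.code [:: 2; q]) => *; exact: S2. Qed.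

Lemma definable_var k i : definable k (fun _ _ s => nth 0 s i).
Proof.
have [ik|ki] := ltnP i k; last first.
  have [e He] := definable_const k 0; exists e => al Y s sk.
  by rewrite nth_default ?sk //; exact: He.
exists (front i (CodeSeq.code [:: 3])) => al Y s sk.
rewrite -[s in input _ _ s](cat_take_drop i s) (drop_nth 0) ?sk //.
rewrite /input map_cat -catA; apply: kleene_front; last exact: S3.
by rewrite size_map size_takel // sk ltnW.
Qed.

Lemma definable_let k f g : definable k g -> definable k.+1 f ->
  definable k (fun al Y s => f al Y (g al Y s :: s)).
Proof.
move=> [eg Hg] [ef Hf]; exists (CodeSeq.code [:: 4; ef; eg]) => al Y s sk.
by apply: S4; [exact: Hg|apply: (Hf al Y (_ :: s)); rewrite /= sk].
Qed.

Lemma definable_shift k g : definable k g ->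
  definable k.+1 (fun al Y s => g al Y (behead s)).
Proof.
move=> [e He]; exists (back (k + 4) e) => al Y [//|x s] [sk].
by apply: kleene_drop; [rewrite size_input sk|exact: He].
Qed.

Lemma definable_op1 f k g : computable1 f -> definable k g ->
  definable k (fun al Y s => f (g al Y s)).
Proof.
move=> [ef Hf] [e He]; exists (CodeSeq.code [:: 4; ef; e]) => al Y s sk.
by apply: S4; [exact: He|exact: Hf].
Qed.

Lemma definable_op2 f k g h : computable2 f -> definable k g -> definable k h ->
  definable k (fun al Y s => f (g al Y s) (h al Y s)).
Proof.
move=> [ef Hf] Hg [eh Hh]; have [eg {}Hg] := definable_shift Hg.
exists (CodeSeq.code [:: 4; CodeSeq.code [:: 4; ef; eg]; eh]) => al Y s sk.
apply: S4; first exact: Hh.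
apply: S4; first by apply: (Hg al Y (_ :: s)); rewrite /= sk.
exact: Hf.
Qed.

Lemma definable_app k g : definable k g ->
  definable k (fun al Y s => al (g al Y s)).
Proof.
move=> [e He]; exists (CodeSeq.code [:: 4; front k.+1 (CodeSeq.code [:: 7]); e]).
move=> al Y s sk; apply: S4; first exact: He.
apply: (@kleene_front _ _ (num _ :: [seq num x | x <- s])).
  by rewrite /= size_map sk.
exact: S7.
Qed.

Lemma definable_ex k g : definable k.+1 g ->
  definable k (fun al Y s => kleene_E2 (fun x => g al Y (x :: s))).
Proof.
(* The quantifier stands behind the k numbers, [al] and [L]. *)
move=> [e He]; exists (abstr k.+2 e) => al Y s sk.
rewrite /input /oracles -[_ :: _ :: _]/([:: TArg al; Arg L] ++ _) catA.
apply: (@kleene_abstr _ 0 _ (fun x => g al Y (x :: s))) => //.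
  by rewrite size_cat size_map sk addn2.
by move=> x; rewrite -catA; apply: (He al Y (x :: s)); rewrite /= sk.
Qed.

Lemma definable_appY k g : definable k.+1 g ->
  definable k (fun al Y s => Y (fun x => g al Y (x :: s))).
Proof.
move=> [e He]; exists (abstr k.+3 e) => al Y s sk.
rewrite /input /oracles -[_ :: _ :: _]/([:: TArg al; Arg L; TArg _] ++ _) catA.
apply: (@kleene_abstr _ 0 _ (fun x => g al Y (x :: s))) => //.
  by rewrite size_cat size_map sk addn3.
by move=> x; rewrite -catA; apply: (He al Y (x :: s)); rewrite /= sk.
Qed.

Lemma definable_least_zero k g : definable k.+1 g ->
  definable k (fun al Y s => least_zero (fun x => g al Y (x :: s))).
Proof.
move=> Hg.
(* If there is no zero, the guard makes the search stop at once. *)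
have [e He] : definable k.+1 (fun al Y s =>
    g al Y s * (1 - kleene_E2 (fun x => g al Y (x :: behead s)))).
  apply: (definable_op2 computable2_mul) => //.
  apply: definable_op2 computable2_sub (definable_const _ _) _.
  exact: (definable_shift (definable_ex Hg)).
have [e' He'] := kleene_search e (k + 4).
exists e' => al Y s sk.
apply: (He' _ (fun x => g al Y (x :: s)
    * (1 - kleene_E2 (fun x => g al Y (x :: s))))).
- by rewrite size_input sk.
- by move=> x; apply: (He al Y (x :: s)); rewrite /= sk.
- rewrite /least_zero; case: pselect => [h|h].
    by case: ex_minnP => n /eqP ->.
  rewrite /kleene_E2 /decide; case: asboolP => [[n /eqP gn]|_]; last by rewrite muln0.
  by case: h; exists n.
- rewrite /least_zero; case: pselect => [h|//].
  case: ex_minnP => n /eqP gn nmin x xn; rewrite muln_eq0 negb_or.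
  apply/andP; split; first by apply: contraTN xn => /nmin; rewrite -leqNgt.
  rewrite /kleene_E2 /decide; case: asboolP => // -[]; first by exists n.
Qed.

End Definable.

(** * A term language with de Bruijn indices, compiled to S1-S9 *)

Inductive term :=
| Var of nat | Const of nat | Add of term & term | Sub of term & term
| Mul of term & term | Exp2 of term | Let of term & term | Oracle of term
| Ex of term | AppY of term | Least of term.

Fixpoint eval (al : tp 1) (Y : tp 2) (t : term) (s : seq nat) : nat :=
  match t with
  | Var i => nth 0 s i
  | Const q => q
  | Add t u => eval al Y t s + eval al Y u s
  | Sub t u => eval al Y t s - eval al Y u s
  | Mul t u => eval al Y t s * eval al Y u s
  | Exp2 t => 2 ^ eval al Y t s
  | Let t u => eval al Y u (eval al Y t s :: s)
  | Oracle t => al (eval al Y t s)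
  | Ex t => kleene_E2 (fun x => eval al Y t (x :: s))
  | AppY t => Y (fun x => eval al Y t (x :: s))
  | Least t => least_zero (fun x => eval al Y t (x :: s))
  end.

(** The induction covers all [k] at once, since [Let], [Ex], [AppY] and [Least] extend the
    environment. *)
Lemma definable_eval L t k : definable L k (fun al Y s => eval al Y t s).
Proof.
elim: t k => /= [i|q|t IHt u IHu|t IHt u IHu|t IHt u IHu|t IHt|t IHt u IHu
  |t IHt|t IHt|t IHt|t IHt] k.
- exact: definable_var.
- exact: definable_const.
- by apply: definable_op2 => //; exact: computable2_add.
- by apply: definable_op2 => //; exact: computable2_sub.
- by apply: definable_op2 => //; exact: computable2_mul.
- by apply: definable_op1 => //; exact: computable1_exp2.
- exact: (@definable_let _ _ (fun al Y s => eval al Y u s)).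
- exact: definable_app.
- exact: (@definable_ex _ _ (fun al Y s => eval al Y t s)).
- exact: (@definable_appY _ _ (fun al Y s => eval al Y t s)).
- exact: (@definable_least_zero _ _ (fun al Y s => eval al Y t s)).
Qed.

(** * Real numbers and their binary digits *)

Local Open Scope ring_scope.

(** Cantor's pairing as a polynomial equation, doubled to avoid division, so that a term can test
    it. *)
Lemma of_natP p a b :
  Cantor.of_nat p = (a, b) <-> (p * 2 = b * 2 + (b + a) * (b + a).+1)%N.
Proof.
have := Cantor.to_nat_spec a b; split=> [pab|eq_p].
  by rewrite -(Cantor.cancel_to_of p) pab; lia.
have -> : p = Cantor.to_nat (a, b) by lia.
exact: Cantor.cancel_of_to.
Qed.

Lemma rat_of_code_even p w d : Cantor.of_nat p = (w.*2, d) ->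
  rat_of_code p = w%:R / d.+1%:R.
Proof. by move=> eq_p; rewrite /rat_of_code eq_p odd_double doubleK. Qed.

Lemma rat_of_code_gt0 p : 0 < rat_of_code p ->
  exists w d, Cantor.of_nat p = (w.*2, d).
Proof.
rewrite /rat_of_code; case: Cantor.of_nat => a b.
case: ifP => [_|aodd _].
  by rewrite mulNr oppr_gt0 ltNge divr_ge0.
by exists a./2, b; rewrite -[a in LHS]odd_double_half aodd.
Qed.

(** * Comparing a coded real with dyadic rationals *)

Section CodedReals.
Variable R : realType.
Implicit Type x : R.

Lemma ltr_dyadic_nat (u i n w d : nat) :
  (u%:R / 2 ^+ i + 2 ^- n < w%:R / d.+1%:R :> R) =
  ((u * 2 ^ n + 2 ^ i) * d.+1 < w * (2 ^ i * 2 ^ n))%N.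
Proof.
have -> : u%:R / 2 ^+ i + 2 ^- n = (u * 2 ^ n + 2 ^ i)%:R / (2 ^ i * 2 ^ n)%:R :> R.
  rewrite natrD !natrM !natrX; field.
  by rewrite !expf_neq0.
by rewrite ltr_pdivrMr ?ltr0n ?muln_gt0 ?expn_gt0 // mulrAC ltr_pdivlMr ?ltr0n //
   -!natrM ltr_nat.
Qed.

Lemma exists_exp2_lt (e : R) : 0 < e -> exists n, forall m, (n <= m)%N -> 2 ^- m < e.
Proof.
move=> e0; exists (Num.truncn e^-1).+1 => m nm.
rewrite invf_plt ?posrE ?exprn_gt0 //.
apply: lt_le_trans (truncnS_gt _) _; rewrite -natrX ler_nat.
exact: leq_trans nm (ltnW (ltn_expl _ _)).
Qed.

(** A strict lower bound shows at a finite stage: some approximation exceeds it by more than the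
    error [2^-n]. That approximation is positive, so its code is a pair (2w, d), and clearing
    denominators leaves arithmetic on naturals. *)
Lemma codes_real_ltP (al : nat -> nat) x (i u : nat) : codes_real al x ->
  u%:R / 2 ^+ i < x <-> exists n w d,
    (al n * 2 = d * 2 + (d + w.*2) * (d + w.*2).+1)%N /\
    ((u * 2 ^ n + 2 ^ i) * d.+1 < w * (2 ^ i * 2 ^ n))%N.
Proof.
move=> [al_fast al_x]; split=> [ux|[n [w [d [/of_natP aln lt_u]]]]].
  (* Half of the gap absorbs [2^-n], the other half the distance from the approximation to [x]. *)
  have e0 : 0 < (x - u%:R / 2 ^+ i) / 2 by lra.
  have [N HN] := exists_exp2_lt e0.
  move/cvgrPdist_lt : al_x => /(_ _ e0) [M _ HM].
  have /= := HM (maxn N M) (leq_maxr _ _); have := HN (maxn N M) (leq_maxl _ _).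
  set n := maxn N M => Hn Hx.
  have lt_n : u%:R / 2 ^+ i + 2 ^- n < ratr (rat_of_code (al n)) :> R.
    by move: Hx; rewrite ltr_norml => /andP[]; lra.
  have : 0 < rat_of_code (al n).
    rewrite -(ltr0q R); apply: le_lt_trans lt_n.
    by rewrite addr_ge0 ?divr_ge0 ?invr_ge0 ?exprn_ge0.
  move=> /rat_of_code_gt0 [w [d aln]]; exists n, w, d; split; first exact/of_natP.
  by move: lt_n; rewrite (rat_of_code_even aln) fmorph_div /= !ratr_nat ltr_dyadic_nat.
have {}lt_u : u%:R / 2 ^+ i + 2 ^- n < ratr (rat_of_code (al n)) :> R.
  by rewrite (rat_of_code_even aln) fmorph_div /= !ratr_nat ltr_dyadic_nat.
rewrite ltNge; apply/negP => xu.
(* If [x] were at most the bound, a late approximation within this gap of [x] would differ from the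
   n-th by more than [2^-n]. *)
have e0 : 0 < ratr (rat_of_code (al n)) - 2 ^- n - x by lra.
move/cvgrPdist_lt : al_x => /(_ _ e0) [M _ HM].
have /= := HM (n + M)%N (leq_addl _ _).
have := al_fast n M; rewrite -(ltr_rat R) ratr_norm rmorphB /= fmorphV rmorphXn /=.
by rewrite ratr_nat !ltr_norml => /andP[_ +] /andP[+ _]; lra.
Qed.
End CodedReals.

(** * Binary digits *)

Section Digits.
Variable R : realType.
Implicit Type x : R.

(** Intervals open on the left select the expansion that does not end in zeros, so positive dyadic
    rationals end in ones. *)
Definition digit x (i : nat) : Prop :=
  exists j : nat, j.*2.+1%:R / 2 ^+ i < x <= j.*2.+2%:R / 2 ^+ i.

Lemma ler_dyadic (a b m : nat) :
  (a%:R / 2 ^+ m <= b%:R / 2 ^+ m :> R) = (a <= b)%N.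
Proof. by rewrite ler_pM2r ?ler_nat // invr_gt0 exprn_gt0. Qed.

Lemma ltr_dyadic (a b m : nat) :
  (a%:R / 2 ^+ m < b%:R / 2 ^+ m :> R) = (a < b)%N.
Proof. by rewrite ltr_pM2r ?ltr_nat // invr_gt0 exprn_gt0. Qed.

Lemma dyadic_interval_unique x i (u u' : nat) :
  u%:R / 2 ^+ i < x <= u.+1%:R / 2 ^+ i ->
  u'%:R / 2 ^+ i < x <= u'.+1%:R / 2 ^+ i -> u = u'.
Proof.
move=> /andP[ux xu] /andP[u'x xu'].
have := lt_le_trans ux xu'; have := lt_le_trans u'x xu.
by rewrite !ltr_dyadic; lia.
Qed.

Lemma digitE x i u : u%:R / 2 ^+ i < x <= u.+1%:R / 2 ^+ i ->
  digit x i <-> odd u.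
Proof.
move=> ux; split=> [[j jx]|oddu].
  by rewrite (dyadic_interval_unique ux jx) /= odd_double.
exists u./2; suff -> : (u./2).*2.+1 = u by [].
by rewrite -[RHS]odd_double_half oddu.
Qed.

(** Dyadic intervals are halved as [b] prescribes, and [x] is the supremum of the left endpoints
    [f i]. Infinitely many ones keep [x] strictly above each of them, as [digit] requires. *)
Lemma binary_expansion (b : nat -> bool) (n j : nat) :
  (forall N, exists2 i, (N <= i)%N & b i) ->
  exists2 x, j%:R / 2 ^+ n < x <= j.+1%:R / 2 ^+ n &
    forall i, digit x (n + i).+1 <-> b i.
Proof.
move=> b_inf.
pose S := fix S i := if i is k.+1 then ((S k).*2 + b k)%N else j.
pose f i : R := (S i)%:R / 2 ^+ (n + i).
pose g i : R := (S i).+1%:R / 2 ^+ (n + i).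
have halve (k m : nat) : k%:R / 2 ^+ m = k.*2%:R / 2 ^+ m.+1 :> R.
  by rewrite exprS -muln2 natrM; field; rewrite expf_neq0.
have fS i : f i <= f i.+1.
  by rewrite /f addnS halve ler_dyadic leq_addr.
have fS_lt i : b i -> f i < f i.+1.
  move=> bi; rewrite /f addnS halve ltr_dyadic /=.
  by rewrite bi addn1.
have gS i : g i.+1 <= g i.
  rewrite /g addnS (halve (S i).+1) ler_dyadic /=.
  by case: (b i); lia.
have f_mono : {homo f : i k / (i <= k)%N >-> i <= k}.
  exact/nondecreasing_seqP.
have g_mono : {homo g : i k / (i <= k)%N >-> k <= i}.
  by apply/nonincreasing_seqP.
have fg i k : f i <= g k.
  apply: le_trans (f_mono _ _ (leq_maxl i k)) _.
  apply: le_trans (g_mono _ _ (leq_maxr i k)).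
  by rewrite ler_dyadic.
have f_ub k : ubound (range f) (g k) by move=> _ [i _ <-].
pose x := sup (range f).
have x_ub i : f i <= x.
  by apply: ub_le_sup; [exists (g 0%N)|exists i].
have xg i : x <= g i by apply: ge_sup => //; exists (f 0%N), 0%N.
have fx i : f i < x.
  have [k ik bk] := b_inf i; apply: lt_le_trans (x_ub k.+1).
  exact: le_lt_trans (f_mono _ _ ik) (fS_lt _ bk).
exists x; first by have := fx 0%N; have := xg 0%N; rewrite /f /g addn0 => -> ->.
move=> i; rewrite -addnS (@digitE _ _ (S i.+1)); last by rewrite fx xg.
by rewrite /= oddD odd_double; case: (b i).
Qed.

Lemma dyadic_in_itv (l r : R) : 0 <= l -> l < r -> exists n j,
  [/\ (0 < j)%N, l < j%:R / 2 ^+ n & j.+1%:R / 2 ^+ n < r].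
Proof.
move=> l0 lr; have e0 : 0 < (r - l) / 2 by lra.
have [n /(_ n (leqnn n)) Hn] := exists_exp2_lt e0.
have p0 : 0 < 2 ^+ n :> R by rewrite exprn_gt0.
(* As [2^-n < (r - l) / 2], two steps of length [2^-n] from the rounded-down [l] stay below [r]. *)
exists n, (Num.truncn (l * 2 ^+ n)).+1; split => //.
  by rewrite ltr_pdivlMr // truncnS_gt.
have : (Num.truncn (l * 2 ^+ n))%:R <= l * 2 ^+ n by rewrite truncn_le mulr_ge0 // ltW.
move: Hn; set t := Num.truncn _ => Hn Ht.
have -> : t.+2%:R / 2 ^+ n = t%:R / 2 ^+ n + 2 * 2 ^- n :> R.
  by rewrite -addn2 natrD mulrDl.
by move: Ht; rewrite -ler_pdivrMr //; lra.
Qed.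

(** At every finer level [j / 2^n] is the right endpoint of its half-open interval, and that
    endpoint has an even numerator. *)
Lemma digit_dyadic (n j i : nat) : (0 < j)%N -> digit (j%:R / 2 ^+ n) (n.+1 + i).
Proof.
move=> j0; exists (j * 2 ^ i).-1; set m := (_ * _)%N.
have m0 : (0 < m)%N by rewrite muln_gt0 j0 expn_gt0.
have -> : j%:R / 2 ^+ n = m.*2%:R / 2 ^+ (n.+1 + i) :> R.
  rewrite addSn exprS exprD -muln2 !natrM natrX; field.
  by rewrite !expf_neq0.
have -> : m.-1.*2.+2 = m.*2 by lia.
by rewrite lexx andbT ltr_dyadic; lia.
Qed.
End Digits.

(** * The set attached to a functional of type 2 *)

Lemma decide_eq0 P : decide P = 0%N <-> P.
Proof. by rewrite /decide; case: asboolP. Qed.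

Lemma eq_decide P Q : (P <-> Q) -> decide P = decide Q.
Proof. by move=> PQ; congr decide; apply/propext. Qed.

Definition position (m k : nat) : nat := ((m + k) * (m + k) + k)%N.

(** With s = m + k the value is s^2 + k, which is less than (s + 1)^2; so it determines s, and then
    k. *)
Lemma position_inj m k m' k' :
  position m k = position m' k' -> m = m' /\ k = k'.
Proof.
have lt_pos a b c d : (a + b < c + d)%N -> (position a b < position c d)%N.
  by rewrite /position => lt_ab; have := leq_mul lt_ab lt_ab; lia.
move=> eq_pos; have [lt1|lt2|eq_sum] := ltngtP (m + k)%N (m' + k')%N.
- by have := lt_pos _ _ _ _ lt1; rewrite eq_pos ltnn.
- by have := lt_pos _ _ _ _ lt2; rewrite eq_pos ltnn.
- by move: eq_pos; rewrite /position eq_sum => /addnI; lia.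
Qed.

Section ZeroSet.
Variable R : realType.
Implicit Type x : R.

Definition decode x (n m : nat) : nat :=
  least_zero (fun k => decide (digit x (n + position m k))).

Lemma decode_dense (f : nat -> nat) (l r : R) : 0 <= l -> l < r ->
  exists x, [/\ l < x < r, exists n, decode x n = f
    & forall N, exists i, ~ digit x (N + i)].
Proof.
move=> l0 lr; have [n [j [_ lj jr]]] := dyadic_in_itv l0 lr.
pose b p := `[< exists m, p = position m (f m) >].
have bP m k : b (position m k) <-> f m = k.
  split=> [/asboolP[m' /position_inj[-> ->]] //|<-].
  by apply/asboolP; exists m.
have [|x /andP[jx xj] xb] := @binary_expansion R b n j.
  move=> N; exists (position N (f N)); last exact/bP.
  by rewrite /position; nia.
exists x; split; first by rewrite (lt_trans lj) ?(le_lt_trans xj).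
  exists n.+1; apply: funext => m; apply: least_zero_unique => k.
  apply/eqP/eqP => [/decide_eq0|->]; first by rewrite addSn xb bP => ->.
  by apply/decide_eq0; rewrite addSn xb bP.
(* The pair [(N, f N + 1)] is off the graph of [f], so the digit at its position is 0. *)
move=> N; exists ((n + position N (f N).+1).+1 - N)%N.
rewrite subnKC; last by rewrite /position; nia.
by rewrite xb bP; lia.
Qed.

Definition zero_set (Y : tp 2) : set R := [set x | 0 <= x <= 1 /\
  (exists n, Y (decode x n) = 0%N) /\ forall N, exists i, ~ digit x (N + i)].

(** * Codes of reals, and the measure of the boundary *)

Lemma rat_of_code_onto (q : rat) : 0 <= q -> exists p, rat_of_code p = q.
Proof.
move=> q0; exists (Cantor.to_nat (`|numq q|%N.*2, `|denq q|%N.-1)).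
rewrite (rat_of_code_even (Cantor.cancel_of_to _)) prednK; last first.
  by rewrite absz_gt0 denq_neq0.
rewrite -[RHS]divq_num_den -[in RHS](gez0_abs (denq_ge0 q)).
by rewrite -[in RHS](@gez0_abs (numq q)) // numq_ge0.
Qed.

Lemma codes_real_exists x : 0 <= x -> exists al, codes_real al x.
Proof.
move=> x0.
(* Approximation from above keeps the rationals nonnegative, and all terms from the n-th on lie in
   one interval of length [2^-n]. *)
have /choice [al Hal] : forall n, exists p, x < ratr (rat_of_code p) < x + 2 ^- n.
  move=> n; have /rat_in_itvoo [q] : x < x + 2 ^- n by rewrite ltrDl invr_gt0 exprn_gt0.
  rewrite in_itv /= => xq; have /rat_of_code_onto [p pq] : 0 <= q.
    by move: xq => /andP[/(le_lt_trans x0)]; rewrite ltr0q => /ltW.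
  by exists p; rewrite pq.
exists al; split.
  move=> n i; rewrite -(ltr_rat R) ratr_norm rmorphB /= fmorphV rmorphXn /= ratr_nat.
  have : (2 ^- (n + i) : R) <= 2 ^- n.
    by rewrite lef_pV2 ?posrE ?exprn_gt0 // ler_weXn2l ?ler1n // leq_addr.
  move/andP: (Hal n) => []; move/andP: (Hal (n + i)%N) => [].
  by rewrite ltr_norml; lra.
apply/cvgrPdist_lt => e /exists_exp2_lt [N HN]; exists N => // n /= /HN.
by have /andP[] := Hal n; rewrite distrC ltr_norml; lra.
Qed.

Lemma subset_of_characteristic (F : tp 2) (A : set R) :
  is_characteristic F A -> subset_of F = A.
Proof.
move=> [A01 FA]; apply/seteqP; split=> x.
  by move=> [x01 [al /(FA _ _ x01) ->]]; case: ifP => // /set_mem.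
move=> Ax; have x01 := A01 _ Ax; split=> //.
have [|al alx] := @codes_real_exists x; first by case/andP: x01.
by exists al => //; rewrite (FA _ _ x01 alx) mem_set.
Qed.

(** Density puts []0, 1[] into the closure, codensity keeps it out of the interior, so the boundary
    has measure at least 1. *)
Lemma boundary_dense_codense (A : set R) : A `<=` [set x | 0 <= x <= 1] ->
  (forall l r : R, 0 <= l -> l < r -> r <= 1 -> exists2 x, l < x < r & A x) ->
  (forall l r : R, 0 <= l -> l < r -> exists2 x, l < x < r & ~ A x) ->
  lebesgue_measure (boundary A) <> 0%E.
Proof.
move=> A01 dense codense.
have sub : `]0, 1[ `<=` boundary A.
  move=> x; rewrite /= in_itv /= => /andP[x0 x1]; split.
    move=> B /nbhs_ballP [e /= e0 eB].
    have [||| y /andP[xy yr] Ay] := dense x (Num.min 1 (x + e)).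
    - exact: ltW.
    - by rewrite lt_min x1 ltrDl.
    - by rewrite ge_min lexx.
    exists y; split=> //; apply: eB; rewrite /ball /= distrC.
    by move: yr; rewrite lt_min ltr_norml => /andP[_]; lra.
  move=> xA; have /andP[{}x0 _] := A01 _ (interior_subset xA).
  move: xA => /nbhs_ballP [e /= e0 eA].
  have [||y /andP[xy yr]] := codense x (x + e) => //; first by rewrite ltrDl.
  by apply; apply: eA; rewrite /ball /= distrC ltr_norml; lra.
have mA : measurable (boundary A : set (measurableTypeR R)).
  apply: measurableD.
    by apply: closed_measurable; exact: closed_closure.
  by apply: open_measurable; exact: open_interior.
move=> A0; have : (lebesgue_measure `]0%R, 1%R[%classic <= 0 :> \bar R)%E.
  by rewrite -A0; apply: le_measure; rewrite ?inE.
by rewrite lebesgue_measure_itv /= lte_fin ltr01 -EFinB subr0 lee_fin ler10.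
Qed.

Lemma boundary_zero_set (Y : tp 2) :
  lebesgue_measure (boundary (zero_set Y)) = 0%E <-> ~ exists f, Y f = 0%N.
Proof.
split=> [A0 [f Yf]|noz].
  apply: (@boundary_dense_codense (zero_set Y)) A0.
  - by move=> x [].
  - move=> l r l0 lr r1; have [x [lxr [n xf] xd]] := decode_dense f l0 lr.
    exists x => //; split; last by split=> //; exists n; rewrite xf.
    by case/andP: lxr => lx xr; rewrite (ltW (le_lt_trans l0 lx)) ltW // (lt_le_trans xr).
  (* A dyadic rational has only ones from some index on, so it lies outside the set. *)
  - move=> l r l0 lr; have [n [j [j0 lj jr]]] := dyadic_in_itv l0 lr.
    exists (j%:R / 2 ^+ n).
      by rewrite lj (le_lt_trans _ jr) // ler_dyadic.
    by move=> [_ [_ /(_ n.+1) [i]]]; apply; exact: digit_dyadic.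
have -> : zero_set Y = set0.
  by apply/seteqP; split=> // x [_ [[n Yn] _]]; apply: noz; exists (decode x n).
by rewrite /boundary closure0 set0D measure0.
Qed.
End ZeroSet.

(** * A program for its characteristic function *)

(** As 0 means yes, a sum is a conjunction. Below, equality is tested by adding both truncated
    differences, and a < b by a + 1 - b. *)
Definition Not (t : term) := Sub (Const 1) t.

Lemma eval_Ex al Y t s :
  eval al Y (Ex t) s = decide (exists x, eval al Y t (x :: s) = 0%N).
Proof. by []. Qed.

Lemma eval_Let al Y t u s :
  eval al Y (Let t u) s = eval al Y u (eval al Y t s :: s).
Proof. by []. Qed.

Lemma eval_Not_eq0 al Y t s :
  eval al Y (Not t) s = 0%N <-> eval al Y t s <> 0%N.
Proof. by rewrite /=; lia. Qed.

Lemma eval_Add_eq0 al Y t u s :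
  eval al Y (Add t u) s = 0%N <-> eval al Y t s = 0%N /\ eval al Y u s = 0%N.
Proof. by rewrite /=; lia. Qed.

(* In the environment [u; j; i], this says that [u / 2 ^ i] is less than the
   real coded by the oracle; cf. [codes_real_ltP]. *)
Definition below : term :=
  let: (d, w, n) := (Var 0, Var 1, Var 2) in let: (u, i) := (Var 3, Var 5) in
  let s := Add d (Add w w) in
  let p := Add (Oracle n) (Oracle n) in
  let q := Add (Add d d) (Mul s (Add s (Const 1))) in
  Ex (Ex (Ex (Add (Add (Sub p q) (Sub q p))
    (Sub (Add (Mul (Add (Mul u (Exp2 n)) (Exp2 i)) (Add d (Const 1))) (Const 1))
       (Mul w (Mul (Exp2 i) (Exp2 n))))))).

Definition digit_term : term :=
  let j := Var 0 in
  Ex (Add (Let (Add (Add j j) (Const 1)) below)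
    (Not (Let (Add (Add j j) (Const 2)) below))).

Definition decode_term : term :=
  let: (k, m, n) := (Var 0, Var 1, Var 2) in
  Least (Let (Add n (Add (Mul (Add m k) (Add m k)) k)) digit_term).

(** The outer [Not] passes from 0 for yes to the value 1 of a characteristic function on its set. *)
Definition zero_set_term : term :=
  Not (Add (Ex (AppY decode_term))
    (Not (Ex (Not (Ex (Not (Let (Add (Var 1) (Var 0)) digit_term))))))).

Section Correctness.
Variable R : realType.
Variables (al : tp 1) (Y : tp 2) (x : R).
Hypothesis al_x : codes_real al x.

Lemma eval_below u j i s :
  eval al Y below [:: u, j, i & s] = decide (u%:R / 2 ^+ i < x).
Proof.
rewrite /below eval_Ex; apply: eq_decide; rewrite (codes_real_ltP _ _ al_x).
split=> [[n]|[n [w [d [eq_al lt_u]]]]].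
  rewrite eval_Ex => /decide_eq0 [w]; rewrite eval_Ex => /decide_eq0 [d].
  move=> /eval_Add_eq0 [/= eq_al lt_u]; exists n, w, d; split; first by lia.
  by rewrite -addn1 -(addn1 d) -subn_eq0; apply/eqP.
exists n; rewrite eval_Ex; apply/decide_eq0; exists w.
rewrite eval_Ex; apply/decide_eq0; exists d.
apply/eval_Add_eq0; split=> /=; first by lia.
by apply/eqP; rewrite subn_eq0 !addn1.
Qed.

Lemma eval_digit i s : eval al Y digit_term (i :: s) = decide (digit x i).
Proof.
have odd_bound j : eval al Y (Add (Add (Var 0) (Var 0)) (Const 1)) (j :: i :: s) = j.*2.+1.
  by rewrite /= addn1 addnn.
have even_bound j : eval al Y (Add (Add (Var 0) (Var 0)) (Const 2)) (j :: i :: s) = j.*2.+2.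
  by rewrite /= addn2 addnn.
rewrite /digit_term eval_Ex; apply: eq_decide; split=> -[j].
  move=> /eval_Add_eq0; rewrite eval_Not_eq0 !eval_Let odd_bound even_bound.
  rewrite !eval_below !decide_eq0 => -[lt_x /negP]; rewrite -leNgt => ge_x.
  by exists j; rewrite lt_x.
move=> /andP[lt_x ge_x]; exists j; apply/eval_Add_eq0.
rewrite eval_Not_eq0 !eval_Let odd_bound even_bound !eval_below !decide_eq0.
by split=> //; apply/negP; rewrite -leNgt.
Qed.

Lemma eval_decode m n s :
  eval al Y decode_term [:: m, n & s] = decode x n m.
Proof.
rewrite /decode -[LHS]/(least_zero _); congr least_zero; apply: funext => k.
exact: (eval_digit (n + position m k) [:: k, m, n & s]).
Qed.

Lemma eval_zero_set : 0 <= x <= 1 ->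
  eval al Y zero_set_term [::] = if x \in zero_set Y then 1%N else 0%N.
Proof.
move=> x01.
rewrite /zero_set_term; set t := Add _ _.
have eval_app n : eval al Y (AppY decode_term) [:: n] = Y (decode x n).
  by apply: (congr1 Y); apply: funext => m; exact: eval_decode.
have tP : eval al Y t [::] = 0%N <-> x \in zero_set Y.
  rewrite in_setE /t eval_Add_eq0 eval_Not_eq0 !eval_Ex !decide_eq0.
  split=> [[[n Yn] inf0]|[_ [[n Yn] inf0]]].
    split=> //; split.
      by exists n; rewrite -Yn eval_app.
    move=> N; apply: contrapT => all1; apply: inf0; exists N.
    rewrite eval_Not_eq0 eval_Ex decide_eq0 => -[i].
    rewrite eval_Not_eq0 eval_Let eval_digit decide_eq0 => Ni.
    by apply: all1; exists i.
  split.
    by exists n; rewrite -Yn eval_app.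
  move=> [N]; rewrite eval_Not_eq0 eval_Ex decide_eq0; apply.
  have [i Ni] := inf0 N; exists i.
  by rewrite eval_Not_eq0 eval_Let eval_digit decide_eq0.
rewrite -[LHS]/(1 - eval al Y t [::])%N.
by case: ifP => [/tP -> //|xn]; case: (eval al Y t [::]) tP => // -[/(_ erefl)]; rewrite xn.
Qed.
End Correctness.

Lemma is_characteristic_zero_set (R : realType) (Y : tp 2) :
  is_characteristic (fun al => eval al Y zero_set_term [::]) (zero_set Y : set R).
Proof. by split=> [x [] //|al x x01 al_x]; exact: eval_zero_set. Qed.

(** The boundary is null exactly when [Y] has no zero, so the two answers are opposite. *)
Lemma L0a_zero_set (R : realType) (Y : tp 2) :
  L0a R (fun al => eval al Y zero_set_term [::]) = Some (1 - kleene_E3 Y)%N.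
Proof.
have FE := @is_characteristic_zero_set R Y.
rewrite /L0a; case: asboolP => [_|[]]; last by exists (zero_set Y : set R).
rewrite (subset_of_characteristic FE) (eq_decide (@boundary_zero_set R Y)).
by rewrite /kleene_E3 /decide; do 2!case: asboolP.
Qed.

Theorem theorem3p19 (R : realType) :
  computes (Arg (L0a R : ptp 3) :: TArg (kleene_E2 : tp 2) :: nil)
    (of_total (kleene_E3 : tp 3) : ptp 3).
Proof.
have [d Hd] := definable_eval (L0a R) zero_set_term 0.
have [e He] := computable2_sub.
(* [abstr 0 d] feeds the function computed by [d] to [L0a]; the rest subtracts the answer from 1. *)
exists (CodeSeq.code [:: 4; CodeSeq.code [:: 4; e; CodeSeq.code [:: 2; 1]];
  abstr 0 d]) => Y v.
set a := (_ ++ _).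
(* Deriving the correct value is enough: values are unique by [kleene_fun], and [kleene_E3] is
   total. *)
suff Ha : kleene (CodeSeq.code [:: 4; CodeSeq.code [:: 4; e; CodeSeq.code [:: 2; 1]];
  abstr 0 d]) a (kleene_E3 Y).
  by split=> [/(kleene_fun Ha) <- //|[<-]].
apply: (@S4 _ _ _ (1 - kleene_E3 Y)%N).
  apply: (@kleene_abstr 0 1 (L0a R) _ d [::] _ _ _ _ (L0a_zero_set R Y)) => //.
  by move=> al; exact: (Hd al Y [::]).
apply: S4; first exact: S2.
have E3K : (1 - (1 - kleene_E3 Y) = kleene_E3 Y)%N.
  by rewrite /kleene_E3 /decide; case: asboolP.
by rewrite -[X in kleene _ _ X]E3K; exact: He.
Qed.
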